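(* Let $c \ge 1$ and $k \ge 1$ be integers. For every integer $n \ge 3c^2 + 6c + 3$ and every integer $p \ge c+2$, no player has a winning strategy in the $p$-player $(c,k)$-nacci Zeckendorf game starting from $n$ copies of $S_1 = 1$.
   Context: For integers $c, k \ge 1$, the $(c,k)$-nacci numbers are defined by $S_1 = 1$; $S_{i+1} = cS_i + cS_{i-1} + \cdots + cS_1 + 1$ for $1 \le i \le k$; and $S_{i+1} = cS_i + cS_{i-1} + \cdots + cS_{i-k}$ for $i \ge k+1$. The $p$-player $(c,k)$-nacci Zeckendorf game (Multiplayer Generalized Zeckendorf Game) on $n$: a position is a finite unordered list (multiset) of $(c,k)$-nacci numbers; the initial position consists of $n$ copies of $S_1$. Players $1, 2, \dots, p$ take turns in cyclic order, starting with Player $1$ (Player $1$ moves again after Player $p$). Here $aS_i$ denotes $a$ copies of $S_i$. On each turn the player whose turn it is makes one of the following moves, provided the terms on the left are present in the list with at least the indicated multiplicities; they are removed and replaced by the terms on the right: 1. $cS_{i-k} \wedge cS_{i-k+1} \wedge \cdots \wedge cS_i \to S_{i+1}$, for $i \ge k+1$; 2. $(c+1)S_1 \wedge cS_2 \wedge \cdots \wedge cS_i \to S_{i+1}$, for $1 \le i \le k$; 3. (a) $(c+1)S_1 \to S_2$; (b) $(c+1)S_i \to S_{i+1}$ for $1 < i < k+1$; (c) $(c+1)S_{k+1} \to S_{k+2} \wedge S_1$; (d) $(c+1)S_i \to S_{i+1} \wedge cS_{i-k-1}$ for $i > k+1$. The game ends when no move is available, and the player who made the final move wins. Player $m$ has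 a winning strategy if Player $m$ can guarantee making the final move no matter what moves the other $p-1$ players make. *)

(* Defs.v *)
From mathcomp Require Import all_boot.
From mathcomp Require Import finmap multiset.
From mathcomp Require Import zify.

Set Implicit Arguments.
Unset Strict Implicit.
Unset Printing Implicit Defensive.

Local Open Scope nat_scope.
Local Open Scope mset_scope.

(* [nacci_rev c k i] is the list [:: S_i; ...; S_1], latest term first; the
   case i = 0 of the first branch yields S_1 = 1. *)
Fixpoint nacci_rev (c k i : nat) : seq nat :=
  if i is i'.+1 then
    let s := nacci_rev c k i' in
    (if i' <= k then c * sumn s + 1 else c * sumn (take k.+1 s)) :: s
  else [::].

(* S_i, indexed from 1; the value at i = 0 is junk and never used below. *)
Definition nacci (c k i : nat) : nat := head 0 (nacci_rev c k i).

Lemma nacci_revE c k i :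
  nacci_rev c k i = rev [seq nacci c k j | j <- iota 1 i].
Proof.
elim: i => [//|i IHi].
have := iotaD 1 i 1; rewrite addn1 add1n => ->.
by rewrite map_cat rev_cat -IHi.
Qed.

Lemma nacci1 c k : nacci c k 1 = 1.
Proof. by rewrite /nacci /= muln0. Qed.

Lemma nacci_small c k i : 1 <= i <= k ->
  nacci c k i.+1 = \sum_(1 <= j < i.+1) c * nacci c k j + 1.
Proof.
move=> /andP[_ ik]; rewrite {1}/nacci /= ik nacci_revE sumn_rev sumn_map.
by rewrite -big_distrr /index_iota subn1.
Qed.

Lemma nacci_large c k i : k.+1 <= i ->
  nacci c k i.+1 = \sum_(i - k <= j < i.+1) c * nacci c k j.
Proof.
move=> ki; rewrite {1}/nacci /= leqNgt ki /= nacci_revE take_rev sumn_rev.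
rewrite size_map size_iota -map_drop drop_iota sumn_map -big_distrr /index_iota.
by congr (_ * \big[_/_]_(j <- iota _ _) _); lia.
Qed.

(* Positions are multisets of values S_i (not of indices i). *)
Notation position := {mset nat}.

Definition initial_position (c k n : nat) : position := msetn n (nacci c k 1).

(* The multiset c S_a /\ c S_(a+1) /\ ... /\ c S_b (empty if b < a). *)
Definition block (c k a b : nat) : position :=
  \big[msetD/mset0]_(a <= j < b.+1) msetn c (nacci c k j).

(* [rule c k l r]: the terms l may be replaced by the terms r. *)
Inductive rule (c k : nat) : position -> position -> Prop :=
| rule1 i : k + 1 <= i ->
    rule c k (block c k (i - k) i) [mset nacci c k i.+1]
| rule2 i : 1 <= i <= k ->
    rule c k (msetn (c + 1) (nacci c k 1) `+` block c k 2 i)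
             [mset nacci c k i.+1]
| rule3a :
    rule c k (msetn (c + 1) (nacci c k 1)) [mset nacci c k 2]
| rule3b i : 1 < i < k + 1 ->
    rule c k (msetn (c + 1) (nacci c k i)) [mset nacci c k i.+1]
| rule3c :
    rule c k (msetn (c + 1) (nacci c k (k + 1)))
             ([mset nacci c k (k + 2)] `+` [mset nacci c k 1])
| rule3d i : k + 1 < i ->
    rule c k (msetn (c + 1) (nacci c k i))
             ([mset nacci c k i.+1] `+` msetn c (nacci c k (i - k - 1))).

Definition move (c k : nat) (x y : position) : Prop :=
  exists l r, [/\ rule c k l r, l `<=` x & y = (x `\` l) `+` r].

Definition game_over (c k : nat) (x : position) : Prop :=
  ~ exists y, move c k x y.

(* A history lists the positions reached after each move so far, oldest first;
   the initial position is not included. *)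
Definition current (c k n : nat) (h : seq position) : position :=
  last (initial_position c k n) h.

Definition to_move (p : nat) (h : seq position) : nat := (size h %% p).+1.

Definition strategy := seq position -> position.

(* The histories that can arise when player m follows s and the other players
   make arbitrary legal moves. *)
Inductive consistent (c k n p m : nat) (s : strategy) : seq position -> Prop :=
| consistent_nil : consistent c k n p m s [::]
| consistent_rcons h y :
    consistent c k n p m s h ->
    move c k (current c k n h) y ->
    (to_move p h = m -> y = s h) ->
    consistent c k n p m s (rcons h y).

Definition final_mover (p : nat) (h : seq position) (m : nat) : Prop :=
  exists h' y, h = rcons h' y /\ to_move p h' = m.

(* The first clause says that s always provides a legal move when player m has
   to move. Infinite plays are not mentioned: every play terminates, since each
   move preserves the sum of the terms and increases \sum B ^ i over the terms
   S_i of the position, for B large enough. *)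
Definition winning_strategy (c k n p m : nat) (s : strategy) : Prop :=
  (forall h, consistent c k n p m s h -> to_move p h = m ->
     ~ game_over c k (current c k n h) ->
     move c k (current c k n h) (s h)) /\
  (forall h, consistent c k n p m s h ->
     game_over c k (current c k n h) -> final_mover p h m).

Definition has_winning_strategy (c k n p m : nat) : Prop :=
  exists s : strategy, winning_strategy c k n p m s.

(* Main.v *)
Require Import Defs.
From mathcomp Require Import all_boot.
From mathcomp Require Import finmap multiset zify.

(** The argument is strategy stealing against a shifted clock.  Suppose that
    player m has a winning strategy s.

    From a position containing (c + 1) S_1 and c S_2, one and the same position
    is reached in one move, by merging c S_2 with c S_1 (if k = 1) or with
    (c + 1) S_1 (if k >= 2), and in two moves, by turning (c + 1) S_1 into S_2
    and then playing (c + 1) S_2 -> S_3, or S_3 and S_1 if k = 1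
    ([move_merge]).  If the opponents of m can choose between these
    two lines, then s produces two consistent histories that end in the same
    position with different players to move.  From there on let both games
    follow the same sequence of positions: where m is to move in one of them,
    copy the answer of s into the other, in which an opponent is to move and
    may play anything legal.  Play is finite, because every move preserves the
    sum of the terms and increases the sum of their squares ([move_measure]),
    so both games end with the same move, and s would have to make m the last
    mover in both: a contradiction ([no_clock_shift]).

    It remains to see that the opponents can bring about such a choice.  They
    make at least c + 1 moves between two moves of m, and by playing only
    (c + 1) S_1 -> S_2 in such a stretch they have c + 1 copies of S_2 when m
    is to move.  The answer of s either leaves some S_2, and then c - 1 further
    copies followed by the fork fit into the next c + 1 moves; or it removes
    (c + 1) S_2, and then it reaches, one move later, the position that the
    opponents could have reached themselves by merging instead of producing
    the last S_2 ([no_free_round]).  If m moves too early for the first stretch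
    to have c + 1 moves, the stretch after the first move of m is used
    instead.  No move uses more than (c + 1) S_1, and at most 3 (c + 1) moves
    that use S_1 are made until the fork is complete, hence the bound
    3 (c + 1) ^ 2 = 3 c ^ 2 + 6 c + 3 on n. *)

Set Implicit Arguments.
Unset Strict Implicit.
Unset Printing Implicit Defensive.

Local Open Scope nat_scope.
Local Open Scope mset_scope.

(** * The (c,k)-nacci numbers and blocks of them *)

Section Numbers.
Variables (c k : nat) (c_gt0 : 0 < c) (k_gt0 : 0 < k).
Local Notation S := (nacci c k).

Lemma nacci_ge i : 0 < i -> c * S i <= S i.+1.
Proof.
move=> i0; case: (leqP i k) => ik.
  rewrite nacci_small ?i0 // big_nat_recr //=; lia.
rewrite nacci_large // big_nat_recr /=; lia.
Qed.

Lemma nacci_gt0 i : 0 < i -> 0 < S i.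
Proof.
case: i => // i _; elim: i => [|i IHi]; first by rewrite nacci1.
apply: leq_trans (nacci_ge _) => //.
by rewrite muln_gt0 c_gt0.
Qed.

Lemma nacci_ltS i : 0 < i -> S i < S i.+1.
Proof.
move=> i0; case: (leqP i k) => ik.
  rewrite nacci_small ?i0 // big_nat_recr //=.
  have : S i <= c * S i by rewrite leq_pmull.
  lia.
have Si' : 0 < S i.-1 by apply: nacci_gt0; lia.
have : S i <= c * S i by rewrite leq_pmull.
have : 0 < c * S i.-1 by rewrite muln_gt0 c_gt0.
rewrite nacci_large // big_nat_recr /=; last lia.
have -> : i = i.-1.+1 by lia.
by rewrite big_nat_recr /=; lia.
Qed.

Lemma nacci_lt i j : 0 < i -> i < j -> S i < S j.
Proof.
move=> i0; elim: j => // j IHj; rewrite ltnS leq_eqVlt => /orP[/eqP<-|ij].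
  exact: nacci_ltS.
by apply: ltn_trans (IHj ij) (nacci_ltS _); lia.
Qed.

Lemma nacci_le i j : 0 < i -> i <= j -> S i <= S j.
Proof.
by move=> i0; rewrite leq_eqVlt => /orP[/eqP-> //|ij]; apply/ltnW/nacci_lt.
Qed.

Lemma nacci_eq i j : 0 < i -> 0 < j -> (S i == S j) = (i == j).
Proof.
move=> i0 j0; case: (ltngtP i j) => [ij|ji|->]; last by rewrite eqxx.
  by have := nacci_lt i0 ij; lia.
by have := nacci_lt j0 ji; lia.
Qed.

(** The number identities behind rules 3(c) and 3(d): write one of the c + 1
    copies by its recurrence and let the other c copies complete the window of
    the next term. *)
Lemma nacci_carry_first : c.+1 * S k.+1 = S k.+2 + S 1.
Proof.
rewrite nacci1 mulSn {1}nacci_small ?k_gt0 ?leqnn //.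
rewrite (@nacci_large _ _ k.+1) // [X in _ = X + _]big_nat_recr /=; last lia.
rewrite subSn // subnn; lia.
Qed.

Lemma nacci_carry i : k + 1 < i -> c.+1 * S i = S i.+1 + c * S (i - k - 1).
Proof.
move=> ki; have -> : i = i.-1.+1 by lia.
rewrite mulSn {1}nacci_large; last lia.
rewrite (@nacci_large _ _ i.-1.+1); last lia.
rewrite [X in _ = X + _]big_nat_recr /=; last lia.
rewrite big_ltn; last lia.
have -> : (i.-1 - k).+1 = i.-1.+1 - k by lia.
have -> : i.-1.+1 - k - 1 = i.-1 - k by lia.
lia.
Qed.

Lemma blockE a b x : block c k a b x = c * count_mem x [seq S j | j <- index_iota a b.+1].
Proof.
rewrite /block; elim: (index_iota _ _) => [|j s IHs].
  by rewrite big_nil mset0E muln0.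
rewrite big_cons msetE2 msetnE IHs /= mulnDr eq_sym.
by case: eqP; rewrite ?muln1 ?muln0.
Qed.

(** The S_j with j >= 1 are distinct, so no value can collect the
    multiplicities of two different indices. *)
Lemma block_le a b x : 0 < a -> block c k a b x <= c.
Proof.
move=> a0; rewrite blockE count_uniq_mem; first by case: (_ \in _); lia.
rewrite map_inj_in_uniq ?iota_uniq // => i j.
rewrite !mem_index_iota => /andP[ai _] /andP[aj _] /eqP.
by rewrite nacci_eq ?(leq_trans a0) // => /eqP.
Qed.

Lemma block_notin a b j : 0 < j < a -> block c k a b (S j) = 0.
Proof.
move=> /andP[j0 ja]; rewrite blockE; apply/eqP; rewrite muln_eq0; apply/orP; right.
rewrite -leqn0 leqNgt -has_count has_pred1; apply/mapP => -[i].
rewrite mem_index_iota => /andP[ai _] /eqP.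
by rewrite nacci_eq ?(leq_trans j0) //; lia.
Qed.

End Numbers.

(** * Every play is finite *)

Section Measure.
Definition wsum (f : nat -> nat) (X : position) := \sum_(x <- X) f x.

Lemma wsumD f X Y : wsum f (X `+` Y) = wsum f X + wsum f Y.
Proof.
rewrite /wsum -big_cat; apply: perm_big; apply/allP => x _ /=.
by rewrite count_cat !count_mem_mset msetE2.
Qed.

Lemma wsum_msetn f n x : wsum f (msetn n x) = n * f x.
Proof. by rewrite /wsum enum_msetn big_nseq iter_addn_0 mulnC. Qed.

Lemma wsum_block f c k a b :
  wsum f (block c k a b) = \sum_(a <= j < b.+1) c * f (nacci c k j).
Proof.
rewrite /block; elim: (index_iota _ _) => [|j s IHs].
  by rewrite !big_nil /wsum big_mset0.
by rewrite !big_cons wsumD IHs wsum_msetn.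
Qed.

Definition total := wsum id.
Definition squares := wsum (fun x => x ^ 2).

(** This bounds [squares] along a play, as the total is invariant. *)
Lemma squares_le_total X : squares X <= total X ^ 2.
Proof.
rewrite /squares /total /wsum; elim: (enum_mset X) => [|x s IHs].
  by rewrite !big_nil.
rewrite !big_cons sqrnD; lia.
Qed.

Variables (c k : nat) (c_gt0 : 0 < c) (k_gt0 : 0 < k).
Local Notation S := (nacci c k).

(** A merge of terms of size at most S_i into the larger number S_(i+1): the
    squares sum to at most S_i * S_(i+1).  The hypothesis on squares is the form
    in which this size bound is additive. *)
Lemma squares_lt_merge l i : 0 < i ->
  total l = S i.+1 -> squares l <= S i * total l ->
  total l = total [mset S i.+1] /\ squares l < squares [mset S i.+1].
Proof.
move=> i0 tl sl; have Sii := nacci_ltS c_gt0 k_gt0 i0.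
rewrite /total /squares !wsum_msetn -/total -/squares !mul1n; split=> //.
apply: leq_ltn_trans sl _; rewrite tl -mulnn ltn_pmul2r //; lia.
Qed.

Lemma squares_block a b : 0 < a ->
  squares (block c k a b) <= S b * total (block c k a b).
Proof.
move=> a0; rewrite /squares /total !wsum_block big_distrr /=.
rewrite big_nat [leqRHS]big_nat.
apply: leq_sum => j /andP[aj jb]; rewrite mulnCA -mulnn leq_mul2l.
by rewrite leq_mul2r nacci_le ?orbT //; lia.
Qed.

(** Merging increases the sum of squares since the sum is fixed.  In rule 3(d)
    the terms spread out from c + 1 equal ones: with a = S_i and
    d = S_(i-k-1), the identity (c + 1) a = S_(i+1) + c d makes the sum of
    squares grow by exactly c (c + 1) (a - d) ^ 2. *)
Lemma rule_measure l r : rule c k l r ->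
  total l = total r /\ squares l < squares r.
Proof.
case=> [i ki|i /andP[i0 ik]||i /andP[i1 ik]||i ki].
- apply: squares_lt_merge; [lia| |apply: squares_block; lia].
  by rewrite /total wsum_block nacci_large ?addn1 // -addn1.
- have tl : total (msetn (c + 1) (S 1) `+` block c k 2 i) = S i.+1.
    rewrite /total wsumD wsum_msetn wsum_block (@nacci_small _ _ i) ?i0 //.
    rewrite [in RHS]big_ltn // nacci1; lia.
  apply: squares_lt_merge => //.
  rewrite /total /squares !wsumD -/total -/squares mulnDr.
  apply: leq_add; last exact: squares_block.
  rewrite /total /squares !wsum_msetn /= nacci1.
  by have := nacci_gt0 c_gt0 k_gt0 i0; nia.
- apply: squares_lt_merge => //;
    rewrite /total /squares !wsum_msetn /= nacci1 ?exp1n ?mul1n //.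
  rewrite (@nacci_small _ _ 1) // big_nat1 nacci1; lia.
- apply: squares_lt_merge; first lia.
    rewrite /total wsum_msetn /= nacci_small; last lia.
    have -> : i = i.-1.+1 by lia.
    rewrite big_nat_recr //= -(prednK (n := i.-1)); last lia.
    rewrite addn1 mulSn {1}nacci_small; lia.
  by rewrite /squares /total !wsum_msetn /= -mulnn mulnCA.
- have := nacci_carry_first c_gt0 k_gt0; rewrite /total /squares !wsumD !wsum_msetn.
  rewrite !addn1 addn2 nacci1 /= => e.
  have := nacci_lt c_gt0 k_gt0 (ltn0Sn 0) (k_gt0 : 1 < k.+1).
  rewrite nacci1; split; nia.
- have := nacci_carry c_gt0 k_gt0 ki; rewrite /total /squares !wsumD !wsum_msetn.
  rewrite !addn1 /= => e; split; first lia.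
  have : S (i - k - 1) < S i by apply: nacci_lt => //; lia.
  move: e; set a := S i; set b := S i.+1; set d := S (i - k - 1).
  move=> e da; have [t ta] : exists t, a = d + t.+1 by exists (a - d).-1; lia.
  have -> : b = a + c * t.+1 by nia.
  rewrite ta; nia.
Qed.

Lemma move_measure X Y : move c k X Y ->
  total X = total Y /\ squares X < squares Y.
Proof.
move=> [l [r [lr lX ->]]]; have [tlr slr] := rule_measure lr.
rewrite -{1 3}(msetBDK lX) /total /squares !wsumD -/total -/squares.
by rewrite tlr ltn_add2l.
Qed.

End Measure.

(** * The two routes to the same position *)

Section Merging.
Variables (c k : nat) (c_gt0 : 0 < c) (k_gt0 : 0 < k).
Local Notation S := (nacci c k).

Definition double (X : position) : position :=
  (X `\` msetn (c + 1) (S 1)) `+` [mset S 2].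

(** What (c + 1) S_2 is replaced by: S_2 is the index k + 1 of rule 3(c) if
    k = 1, and falls under rule 3(b) otherwise. *)
Definition carry : position :=
  if k == 1 then [mset S 3] `+` [mset S 1] else [mset S 3].

Definition promote (X : position) : position :=
  (X `\` msetn (c + 1) (S 2)) `+` carry.

Lemma S_neq i j : 0 < i -> 0 < j -> i != j -> (S i == S j) = false.
Proof. by move=> i0 j0 ij; rewrite nacci_eq // (negbTE ij). Qed.

Lemma double1 (X : position) : double X (S 1) = X (S 1) - (c + 1).
Proof. by rewrite !msetE2 !msetnE eqxx S_neq // addn0. Qed.

Lemma double2 (X : position) : double X (S 2) = (X (S 2)).+1.
Proof. by rewrite !msetE2 !msetnE eqxx S_neq // subn0 addn1. Qed.

Lemma iter_double1 t (X : position) : iter t double X (S 1) = X (S 1) - t * (c + 1).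
Proof.
elim: t => [|t IHt]; first by rewrite subn0.
by rewrite iterS double1 IHt -subnDA mulSn addnC.
Qed.

Lemma iter_double2 t (X : position) : iter t double X (S 2) = X (S 2) + t.
Proof. by elim: t => [|t IHt]; rewrite ?addn0 // iterS double2 IHt addnS. Qed.

Lemma msetn_sub n x (X : position) : (msetn n x `<=` X) = (n <= X x).
Proof.
apply/msubsetP/idP => [/(_ x)|nX y]; first by rewrite msetnxx.
by rewrite msetnE; case: eqP => // ->.
Qed.

Lemma move_double (X : position) : c < X (S 1) -> move c k X (double X).
Proof.
move=> X1; exists (msetn (c + 1) (S 1)), [mset S 2].
by split=> //; [exact: rule3a | rewrite msetn_sub addn1].
Qed.

Lemma move_promote (X : position) : c < X (S 2) -> move c k X (promote X).
Proof.
move=> X2; exists (msetn (c + 1) (S 2)), carry.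
split=> //; last by rewrite msetn_sub addn1.
rewrite /carry; case: eqP => [k1|k1]; last by apply: rule3b; lia.
by have := rule3c c k; rewrite k1.
Qed.

(** The shortcut of the whole argument: one application of rule 1 (if k = 1)
    or rule 2 (if k >= 2), with i = 2, has the same effect as the two moves
    [double] and [promote].  For k = 1 the S_1 returned by [carry] accounts for
    rule 1 taking only c copies of S_1. *)
Lemma move_merge (X : position) : c < X (S 1) -> c <= X (S 2) ->
  move c k X (promote (double X)).
Proof.
move=> X1 X2; have [k1|k1] := eqVneq k 1.
  exists (block c k 1 2), [mset S 3]; split.
  - by have := @rule1 c k 2; rewrite k1; apply.
  - rewrite /block big_ltn // big_ltn // big_geq // msetD0.
    apply/msubsetP => x; rewrite !msetE2 !msetnE.
    case: eqP => [->|_]; first by rewrite S_neq // addn0 ltnW.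
    by case: eqP => [->|_].
  rewrite /promote /double /carry k1 eqxx /block big_ltn // big_ltn // big_geq // msetD0.
  have n12 := @S_neq 1 2 isT isT isT; have n23 := @S_neq 2 3 isT isT isT.
  have n13 := @S_neq 1 3 isT isT isT; rewrite k1 in n12 n13 n23 X1 X2.
  apply/msetP => x; rewrite !msetE2 !msetnE.
  case: (eqVneq x (nacci c 1 1)) => [->|_]; first by rewrite n12 n13; lia.
  case: (eqVneq x (nacci c 1 2)) => [->|_]; first by rewrite n23; lia.
  lia.
exists (msetn (c + 1) (S 1) `+` block c k 2 2), [mset S 3]; split.
- by apply: rule2; lia.
- rewrite /block big_ltn // big_geq // msetD0.
  apply/msubsetP => x; rewrite !msetE2 !msetnE.
  case: eqP => [->|_]; first by rewrite S_neq // addn0 addn1.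
  by case: eqP => [->|_].
rewrite /promote /double /carry (negbTE k1) /block big_ltn // big_geq // msetD0.
have n12 := @S_neq 1 2 isT isT isT; have n23 := @S_neq 2 3 isT isT isT.
apply/msetP => x; rewrite !msetE2 !msetnE.
case: (eqVneq x (S 1)) => [->|_]; first by rewrite n12; lia.
case: (eqVneq x (S 2)) => [->|_]; first by rewrite n23; lia.
lia.
Qed.

(** Blocks contain each value at most c times, so a rule taking more than c
    copies of S_2 is rule 3 with i = 2. *)
Lemma rule_uses (l r : position) : rule c k l r ->
  l (S 1) <= c + 1 /\ (l (S 2) <= c \/ l = msetn (c + 1) (S 2) /\ r = carry).
Proof.
have S12 : (S 1 == S 2) = false by apply: S_neq.
have uses1 i : 0 < i -> msetn (c + 1) (S i) (S 1) <= c + 1.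
  by move=> i0; rewrite msetnE; case: ifP.
have uses2 i : 0 < i -> i != 2 -> msetn (c + 1) (S i) (S 2) = 0.
  by move=> i0 i2; rewrite msetnE S_neq // eq_sym.
case=> [i ki|i /andP[i0 ik]||i /andP[i1 ik]||i ki].
- have b x := @block_le c k c_gt0 k_gt0 (i - k) i x.
  split; last by left; apply: b; lia.
  by apply: leq_trans (b _ _) _; lia.
- rewrite !msetE2 uses2 // block_notin //; split; last left.
    by rewrite addn0 uses1.
  exact: block_le.
- by rewrite uses2 //; split; [exact: uses1|left].
- split; first by apply: uses1; lia.
  have [i2|i2] := eqVneq i 2; last by left; rewrite uses2 //; lia.
  right; rewrite i2 /carry ifF //; lia.
- split; first by apply: uses1; lia.
  have [k1|k1] := eqVneq k 1; last by left; rewrite uses2 //; lia.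
  by right; rewrite /carry k1.
- split; first by apply: uses1; lia.
  by left; rewrite uses2 //; lia.
Qed.

Lemma move_uses (X Y : position) : move c k X Y ->
  X (S 1) <= Y (S 1) + (c + 1) /\
  (X (S 2) <= Y (S 2) + c \/ Y = promote X).
Proof.
move=> [l [r [lr /msubsetP lX ->]]]; have [l1 l2] := rule_uses lr.
rewrite !msetE2; split; first by have := lX (S 1); lia.
case: l2 => [l2|[-> ->]]; [left|by right].
by have := lX (S 2); lia.
Qed.

End Merging.

(** * Strategy stealing *)

Section Game.
Variables (c k n p m : nat) (c_gt0 : 0 < c) (k_gt0 : 0 < k).
Variables (p_ge : c + 2 <= p) (s : strategy).
Hypothesis win : winning_strategy c k n p m s.
Local Notation S := (nacci c k).
Local Notation consistent := (consistent c k n p m s).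
Local Notation current := (current c k n).

Lemma current_rcons (h : seq position) y : current (rcons h y) = y.
Proof. by rewrite /Defs.current last_rcons. Qed.

Lemma to_move_rcons h1 h2 y1 y2 :
  (to_move p (rcons h1 y1) == to_move p (rcons h2 y2)) =
  (to_move p h1 == to_move p h2).
Proof.
rewrite /to_move !size_rcons !eqSS -(addn1 (size h1)) -(addn1 (size h2)).
exact: eqn_modDr.
Qed.

Lemma to_move_next h1 h2 : size h2 = (size h1).+1 ->
  to_move p h1 <> to_move p h2.
Proof.
rewrite /to_move => -> [] /eqP; rewrite -(addn1 (size h1)).
rewrite -[X in X == _ %[mod _]]addn0 eqn_modDl mod0n modn_small //; lia.
Qed.

Lemma consistent_other h y : consistent h -> to_move p h <> m ->
  move c k (current h) y -> consistent (rcons h y).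
Proof. by move=> ch hm hy; apply: consistent_rcons. Qed.

Lemma consistent_answer h y : consistent h -> to_move p h = m ->
  move c k (current h) y ->
  consistent (rcons h (s h)) /\ move c k (current h) (s h).
Proof.
move=> ch hm hy; have ms : move c k (current h) (s h).
  by apply: win.1 => //; apply; exists y.
by split=> //; apply: consistent_rcons.
Qed.

(** Both histories are continued by the same move.  As m is to move in at most
    one of the two games, s dictates at most one of the two continuations, and
    the other game can follow.  When the common position has no move left, the
    last movers of the two games are still different, but s wins both. *)
Lemma no_clock_shift h1 h2 : consistent h1 -> consistent h2 ->
  current h1 = current h2 -> to_move p h1 <> to_move p h2 -> False.
Proof.
(* Induction on how far the sum of squares is from its upper bound. *)
have [N] := ubnP (total (current h1) ^ 2 - squares (current h1)).
elim: N h1 h2 => // N IHN h1 h2 ltN ch1 ch2 e12 neq12.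
have step y1 y2 : consistent (rcons h1 y1) -> consistent (rcons h2 y2) ->
    y1 = y2 -> move c k (current h1) y1 -> False.
  move=> c1 c2 ey hy; apply: (IHN _ _ _ c1 c2); rewrite ?current_rcons //.
    have [tt' ss'] := move_measure c_gt0 k_gt0 hy.
    by have := squares_le_total y1; rewrite tt' in ltN *; lia.
  by move=> /eqP; rewrite to_move_rcons => /eqP.
have no : ~ game_over c k (current h1).
  move=> over1; have over2 : game_over c k (current h2) by rewrite -e12.
  have [g1 [y1 [e1 t1]]] := win.2 _ ch1 over1.
  have [g2 [y2 [e2 t2]]] := win.2 _ ch2 over2.
  by apply: neq12; apply/eqP; rewrite e1 e2 to_move_rcons t1 t2.
apply: no => -[y hy]; have hy2 := hy; rewrite e12 in hy2.
case: (eqVneq (to_move p h1) m) => [h1m|/eqP h1m].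
  have [c1 m1] := consistent_answer ch1 h1m hy.
  apply: (step _ _ c1 _ erefl m1); apply: consistent_other => //.
    by rewrite -h1m => /esym.
  by rewrite -e12.
case: (eqVneq (to_move p h2) m) => [h2m|/eqP h2m].
  have [c2 m2] := consistent_answer ch2 h2m hy2.
  by apply: (step (s h2) _ _ c2) => //; [apply: consistent_other|]; rewrite ?e12.
by apply: (step y y) => //; apply: consistent_other.
Qed.

Definition others_next (h : seq position) t :=
  forall i, i < t -> ((size h + i) %% p).+1 <> m.

Lemma others_next_le h t u : u <= t -> others_next h t -> others_next h u.
Proof. by move=> ut ht i iu; apply: ht; apply: leq_trans ut. Qed.

Lemma others_next_later h h' t u : size h' = size h + t ->
  others_next h (t + u) -> others_next h' u.
Proof. by move=> e ht i iu; rewrite e -addnA; apply: ht; rewrite ltn_add2l. Qed.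

Lemma others_next_cons h t : others_next h t.+1 -> to_move p h <> m.
Proof. by move=> /(_ 0 isT); rewrite addn0. Qed.

Lemma others_next_rcons h y t :
  others_next h t.+1 -> others_next (rcons h y) t.
Proof. by apply: (@others_next_later _ _ 1); rewrite size_rcons addn1. Qed.

Lemma others_next_after h y : to_move p h = m -> others_next (rcons h y) c.+1.
Proof.
rewrite /to_move => hm i ic; rewrite -{}hm => -[] /eqP.
rewrite size_rcons addSnnS -[X in _ == X %[mod _]](addn0 (size h)) eqn_modDl mod0n.
by rewrite modn_small //; lia.
Qed.

Lemma play_doubles h t : consistent h -> others_next h t ->
  t * (c + 1) <= current h (S 1) ->
  exists h', [/\ consistent h', size h' = size h + t &
                 current h' = iter t (double c k) (current h)].
Proof.
move=> ch; elim: t => [|t IHt] ht hS; first by exists h; rewrite addn0.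
have [||h' [ch' szh' curh']] := IHt.
- exact: others_next_le ht.
- by apply: leq_trans hS; rewrite leq_mul2r leqnSn orbT.
exists (rcons h' (double c k (current h'))); split.
- apply: consistent_other => //.
    apply: (@others_next_cons _ 0); apply: (others_next_later szh').
    by rewrite addn1.
  by apply: move_double => //; rewrite curh' iter_double1 //; lia.
- by rewrite size_rcons szh' addnS.
- by rewrite current_rcons curh'.
Qed.

(** The opponents may take either route of [move_merge], and the routes differ
    in length by one move. *)
Lemma no_fork h : consistent h -> others_next h 2 ->
  c < current h (S 1) -> c <= current h (S 2) -> False.
Proof.
move=> ch h2 X1 X2; set Y := double c k (current h).
have hY : consistent (rcons h Y).
  by apply: consistent_other (others_next_cons h2) _ => //; apply: move_double.
have hZ : consistent (rcons h (promote c k Y)).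
  by apply: consistent_other (others_next_cons h2) _ => //; apply: move_merge.
have hYZ : consistent (rcons (rcons h Y) (promote c k Y)).
  apply: consistent_other => //.
    exact: others_next_cons (others_next_rcons h2).
  by rewrite current_rcons; apply: move_promote => //; rewrite double2.
apply: (no_clock_shift hZ hYZ); rewrite ?current_rcons //.
by apply: to_move_next; rewrite !size_rcons.
Qed.

(** Starting with a copies of S_2, the opponents first produce the c - a missing
    ones. *)
Lemma no_prepared_fork h a : consistent h -> others_next h (c - a).+2 ->
  a <= current h (S 2) -> (c - a).+1 * (c + 1) <= current h (S 1) -> False.
Proof.
move=> ch ha X2 X1.
have [||h' [ch' szh' curh']] := @play_doubles h (c - a) ch.
- by apply: others_next_le ha; lia.
- lia.
apply: (no_fork ch'); rewrite ?curh' ?iter_double1 ?iter_double2 //; try lia.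
by apply: (others_next_later szh'); rewrite addn2.
Qed.

(** The opponents play [double] for c + 1 moves.  If the next move is theirs
    too, they had room for a fork from scratch.  If it belongs to m, the answer
    of s either leaves an S_2, from which [no_prepared_fork] needs just the
    c + 1 moves before m is back, or it is [promote]. *)
Lemma no_free_round h : consistent h -> others_next h c.+1 ->
  2 * c.+1 * (c + 1) <= current h (S 1) -> False.
Proof.
move=> ch hc X1.
case: (eqVneq ((size h + c.+1) %% p).+1 m) => [tm|/eqP tm]; last first.
  apply: (@no_prepared_fork h 0) => //; rewrite ?subn0; last lia.
  move=> i; rewrite ltnS leq_eqVlt => /orP[/eqP-> //|]; exact: hc.
(* h1 is the line with c + 1 doublings, h2 the one with c doublings, which the
   opponents can complete by a merge. *)
have [||h1 [ch1 szh1 curh1]] := @play_doubles h c.+1 ch => //; first lia.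
have [||h2 [ch2 szh2 curh2]] := @play_doubles h c ch; first 2 last.
- have h2m : to_move p h2 <> m by rewrite /to_move szh2; apply: hc.
  have ch3 : consistent (rcons h2 (promote c k (current h1))).
    apply: consistent_other => //; rewrite curh1 iterS -curh2.
    by apply: move_merge; rewrite // curh2 ?iter_double1 ?iter_double2 //; lia.
  have h1m : to_move p h1 = m by rewrite /to_move szh1.
  have mh1 : move c k (current h1) (double c k (current h1)).
    by apply: move_double => //; rewrite curh1 iter_double1 //; lia.
  have [ch4 m4] := consistent_answer ch1 h1m mh1.
  have [Y1] := move_uses c_gt0 k_gt0 m4; rewrite curh1 iter_double1 // in Y1.
  rewrite {1}curh1 iter_double2 // => -[Y2|Yp].
    apply: (@no_prepared_fork _ 1 ch4); rewrite ?current_rcons; try lia.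
    by have := @others_next_after h1 (s h1) h1m; apply: others_next_le; lia.
  (* The answer is [promote], so the line h1 has arrived where the merge leads
     from h2, but one move later. *)
  apply: (no_clock_shift ch3 ch4); rewrite ?current_rcons //.
  by apply: to_move_next; rewrite !size_rcons szh1 szh2 addnS.
- by apply: others_next_le hc.
- lia.
Qed.

(** If m > c + 1, the c + 1 moves needed by [no_free_round] come before the
    first move of m; otherwise they come right after it, and the at most c
    opponents moving before m play [double], which leaves m with a legal
    move. *)
Lemma no_strategy : 0 < m -> 3 * c ^ 2 + 6 * c + 3 <= n -> False.
Proof.
move=> m0 hn; have n1 : current [::] (S 1) = n.
  by rewrite /Defs.current /= /initial_position msetnxx.
have c0 : consistent [::] by constructor.
have [mc|mc] := leqP m c.+1; last first.
  apply: (no_free_round c0); last by rewrite n1; nia.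
  by move=> i ic e; have := leq_mod i p; rewrite add0n in e; lia.
have [||h [ch szh curh]] := @play_doubles [::] m.-1 c0.
- by move=> i im; rewrite add0n modn_small; lia.
- by rewrite n1; nia.
have hm : to_move p h = m by rewrite /to_move szh add0n modn_small; lia.
have h1 : current h (S 1) = n - m.-1 * (c + 1) by rewrite curh iter_double1 // n1.
have mh : move c k (current h) (double c k (current h)).
  by apply: move_double => //; rewrite h1; nia.
have [ch' mh'] := consistent_answer ch hm mh.
have [Y1 _] := move_uses c_gt0 k_gt0 mh'.
apply: (no_free_round ch'); first exact: others_next_after.
rewrite current_rcons; nia.
Qed.

End Game.

Theorem theorem1p8 (c k : nat) (hc : 1 <= c) (hk : 1 <= k)
    (n : nat) (hn : 3 * c ^ 2 + 6 * c + 3 <= n)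
    (p : nat) (hp : c + 2 <= p) :
  forall m : nat, 1 <= m <= p -> ~ has_winning_strategy c k n p m.
Proof.
by move=> m /andP[m0 _] [s win]; apply: (no_strategy hc hk hp win m0 hn).
Qed.
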